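(* Let $(M,\varphi,g)$ be an almost Golden Riemannian manifold. Then: (i) The first canonical connection and the well adapted connection of $(\varphi,g)$ coincide if and only if $\varphi$ is integrable. (ii) The Levi-Civita connection of $g$ and the well adapted connection of $(\varphi,g)$ coincide if and only if the Levi-Civita connection is adapted to $(\varphi,g)$. In this case, both connections also coincide with the first canonical connection.
   Context: Manifolds and tensor fields are of class $C^\infty$; $\mathfrak{X}(M)$ denotes the module of vector fields on $M$. An almost Golden structure on $M$ is a tensor field $\varphi$ of type $(1,1)$ with $\varphi^2=\varphi+Id$ (a polynomial structure of degree exactly 2, i.e. $\varphi$ and $Id$ are linearly independent). An almost Golden Riemannian manifold $(M,\varphi,g)$ is a manifold with an almost Golden structure $\varphi$ and a Riemannian metric $g$ such that $g(\varphi X,Y)=g(X,\varphi Y)$ for all $X,Y\in\mathfrak{X}(M)$. The induced almost product structure is $J_\varphi=\frac{1}{\sqrt5}(2\varphi-Id)$, which satisfies $J_\varphi^2=Id$. The structure $\varphi$ is integrable if its Nijenhuis tensor $N_\varphi(X,Y)=\varphi^2[X,Y]+[\varphi X,\varphi Y]-\varphi[\varphi X,Y]-\varphi[X,\varphi Y]$ vanishes. A linear connection with covariant derivative $\nabla$ is adapted to $(\varphi,g)$ if $\nabla\varphi=0$ and $\nabla g=0$. The first canonical connection is the linear connection with covariant derivative $\nabla^{0}_XY=\nabla^{\mathrm g}_XY-\frac12(\nabla^{\mathrm g}_XJ_\varphi)J_\varphi Y$, where $\nabla^{\mathrm g}$ is the Levi-Civita connection of $g$. Let $D_\phi=\ker(\varphi-\phi\,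 Id)$ and $D_{\bar\phi}=\ker(\varphi-\bar\phi\, Id)$ with $\phi=\frac{1+\sqrt5}{2}$, $\bar\phi=\frac{1-\sqrt5}{2}$. The well adapted connection of $(\varphi,g)$ is the linear connection whose covariant derivative is the unique $\nabla^{\mathrm w}$ adapted to $(\varphi,g)$ whose torsion tensor $\mathrm{T}^{\mathrm w}$ satisfies $g(\mathrm{T}^{\mathrm w}(X,Y),Z)=g(\mathrm{T}^{\mathrm w}(Z,Y),X)$ for all $Y\in\mathfrak{X}(M)$ whenever $X,Z$ are both vector fields in $D_\phi$ or both vector fields in $D_{\bar\phi}$. *)

(* Defs.v *)
From HB Require Import structures.
From mathcomp Require Import all_boot all_order all_algebra.
From mathcomp Require Import ring.
From mathcomp Require Import all_classical all_reals all_analysis.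

Set Implicit Arguments.
Unset Strict Implicit.
Unset Printing Implicit Defensive.

Import Order.TTheory GRing.Theory Num.Theory.
Import numFieldNormedType.Exports.

Local Open Scope classical_set_scope.
Local Open Scope ring_scope.

(* C^k and smooth functions on an open subset U of R^n: at each order the
   function is continuous on U, and its partial derivatives exist on U and
   have the preceding order of regularity. *)
Section EuclideanSmoothness.
Variables (R : realType) (n : nat).
Implicit Types (U : set 'rV[R]_n) (f g : 'rV[R]_n -> R^o).

Fixpoint Ck (k : nat) U f : Prop :=
  (forall x, U x -> {for x, continuous f}) /\
  if k is k'.+1 then
    forall i : 'I_n, (forall x, U x -> derivable f x (delta_mx 0 i)) /\
                     Ck k' U (fun x => 'D_(delta_mx 0 i) f x)
  else True.

Definition smooth_on U f := forall k, Ck k U f.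

Lemma CkS k U f : Ck k.+1 U f -> Ck k U f.
Proof.
elim: k f => [|k IH] f [cf df]; split=> // i.
by have [df1 df2] := df i; split=> //; exact: IH.
Qed.

Lemma Ck_ext k U f g : open U -> (forall x, U x -> f x = g x) ->
  Ck k U f -> Ck k U g.
Proof.
move=> oU; have nearU x : U x -> \near x, U x.
  by move=> Ux; apply: open_nbhs_nbhs.
have nfg (h1 h2 : 'rV[R]_n -> R^o) x :
    (forall x, U x -> h1 x = h2 x) -> U x -> {near x, h1 =1 h2}.
  by move=> h12 /nearU; apply: filterS => y; exact: h12.
have cg (h1 h2 : 'rV[R]_n -> R^o) : (forall x, U x -> h1 x = h2 x) ->
    (forall x, U x -> {for x, continuous h1}) ->
    forall x, U x -> {for x, continuous h2}.
  move=> h12 ch x Ux; rewrite /prop_for /continuous_at -h12//.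
  exact: cvg_trans (near_eq_cvg (nfg _ _ _ h12 Ux)) (ch x Ux).
elim: k f g => [|k IH] f g fg [cf df]; split=> //; try exact: cg cf.
move=> i; have [df1 df2] := df i; split=> [x Ux|].
  exact: near_eq_derivable (nfg _ _ _ fg Ux) (df1 _ Ux).
by apply: IH df2 => x Ux; exact: near_eq_derive (nfg _ _ _ fg Ux).
Qed.

Lemma CkP k U f :
  (forall x, U x -> {for x, continuous f}) ->
  (forall k', k = k'.+1 -> forall i : 'I_n,
    (forall x, U x -> derivable f x (delta_mx 0 i)) /\
    Ck k' U (fun x => 'D_(delta_mx 0 i) f x)) -> Ck k U f.
Proof. by case: k => [|k] cf df; split=> //; exact: df. Qed.

Lemma Ck_cst k U (a : R) : Ck k U (fun=> a).
Proof.
elim: k a => [|k IH] a;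
  (apply: CkP; first by move=> x _; exact: cst_continuous); move=> k' // [<-] i.
split=> [x _|]; first exact: derivable_cst.
have -> : (fun x => 'D_(delta_mx 0 i) (fun=> a : R^o) x) =
    (fun _ : 'rV[R]_n => 0 : R^o).
  by apply/funext => x; exact: derive_cst.
exact: IH.
Qed.

Lemma CkD k U f g : open U -> Ck k U f -> Ck k U g -> Ck k U (f + g).
Proof.
move=> oU; elim: k f g => [|k IH] f g [cf df] [cg dg];
  (apply: CkP; first by move=> x Ux; exact: continuousD (cf _ Ux) (cg _ Ux));
  move=> k' // [<-] i.
have [df1 df2] := df i; have [dg1 dg2] := dg i; split=> [x Ux|].
  exact: derivableD (df1 _ Ux) (dg1 _ Ux).
apply: (Ck_ext oU _ (IH _ _ df2 dg2)) => x Ux.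
by rewrite (deriveD (df1 _ Ux) (dg1 _ Ux)).
Qed.

Lemma CkM k U f g : open U -> Ck k U f -> Ck k U g -> Ck k U (f * g).
Proof.
move=> oU; elim: k f g => [|k IH] f g Cf Cg;
  have [[cf df] [cg dg]] := (Cf, Cg);
  (apply: CkP; first by move=> x Ux; exact: continuousM (cf _ Ux) (cg _ Ux));
  move=> k' // [<-] i.
have [df1 df2] := df i; have [dg1 dg2] := dg i; split=> [x Ux|].
  exact: derivableM (df1 _ Ux) (dg1 _ Ux).
apply: (Ck_ext oU _ (CkD oU (IH _ _ (CkS Cf) dg2) (IH _ _ (CkS Cg) df2))).
move=> x Ux.
by rewrite (deriveM (df1 _ Ux) (dg1 _ Ux)).
Qed.

End EuclideanSmoothness.

Section Manifold.
Variables (R : realType) (n : nat).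

(* A homeomorphism from an open subset of M onto an open subset of R^n;
   chart_inv is only meaningful on the image. *)
Record chart (M : topologicalType) := Chart {
  chart_dom : set M;
  chart_map : M -> 'rV[R]_n;
  chart_inv : 'rV[R]_n -> M;
  chart_dom_open : open chart_dom;
  chart_img_open : open (chart_map @` chart_dom);
  chart_mapK : forall p, chart_dom p -> chart_inv (chart_map p) = p;
  chart_map_cts : forall p, chart_dom p -> {for p, continuous chart_map};
  chart_inv_cts : forall y, (chart_map @` chart_dom) y ->
    {for y, continuous chart_inv} }.

Definition smoothly_compatible (M : topologicalType) (c d : chart M) :=
  forall j : 'I_n,
    smooth_on (chart_map c @` (chart_dom c `&` chart_dom d))
              (fun y => chart_map d (chart_inv c y) 0 j).

Record manifold := Manifold {
  carrier :> topologicalType;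
  manifold_hausdorff : hausdorff_space carrier;
  manifold_second_countable : @second_countable carrier;
  atlas : set (chart carrier);
  atlas_cover : forall p, exists2 c, atlas c & chart_dom c p;
  atlas_compatible : forall c d, atlas c -> atlas d ->
    smoothly_compatible c d }.

Definition is_smooth (M : manifold) (f : M -> R^o) :=
  forall c, atlas c ->
    smooth_on (chart_map c @` chart_dom c) (f \o chart_inv c).

End Manifold.

Section SmoothFunctions.
Variables (R : realType) (n : nat) (M : manifold R n).

Definition smooth_pred : {pred M -> R^o} :=
  mem [set f : M -> R^o | is_smooth f].

Record smooth := Smooth {
  smooth_val :> M -> R^o;
  smoothP : smooth_val \in smooth_pred }.

HB.instance Definition _ := [isSub for smooth_val].
HB.instance Definition _ := [Choice of smooth by <:].

Lemma is_smooth_cst (a : R) : is_smooth (fun _ : M => a).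
Proof. by move=> c _ k; exact: Ck_cst. Qed.

Lemma is_smoothD (f g : M -> R^o) :
  is_smooth f -> is_smooth g -> is_smooth (f + g).
Proof.
by move=> sf sg c Ac k; apply: CkD (sf _ Ac k) (sg _ Ac k);
  exact: chart_img_open.
Qed.

Lemma is_smoothM (f g : M -> R^o) :
  is_smooth f -> is_smooth g -> is_smooth (f * g).
Proof.
by move=> sf sg c Ac k; apply: CkM (sf _ Ac k) (sg _ Ac k);
  exact: chart_img_open.
Qed.

Lemma is_smoothZ (a : R) (f : M -> R^o) : is_smooth f -> is_smooth (a *: f).
Proof. by move=> sf; apply: is_smoothM (is_smooth_cst a) sf. Qed.

Lemma is_smoothB (f g : M -> R^o) :
  is_smooth f -> is_smooth g -> is_smooth (f - g).
Proof.
by move=> sf sg; rewrite -scaleN1r; apply: is_smoothD => //; exact: is_smoothZ.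
Qed.

Lemma smooth_subring_closed : subring_closed smooth_pred.
Proof.
split=> [|f g|f g]; rewrite !inE /=.
- exact: is_smooth_cst.
- exact: is_smoothB.
- exact: is_smoothM.
Qed.

HB.instance Definition _ :=
  GRing.isSubringClosed.Build _ smooth_pred smooth_subring_closed.

Lemma smooth_scaler_closed : scaler_closed smooth_pred.
Proof. by move=> a f; rewrite !inE /=; exact: is_smoothZ. Qed.

HB.instance Definition _ :=
  GRing.isScaleClosed.Build R _ smooth_pred smooth_scaler_closed.
HB.instance Definition _ := 
  GRing.SubChoice_isSubComPzRing.Build _ _ smooth smooth_subring_closed.
HB.instance Definition _ := [SubZmodule_isSubLmodule of smooth by <:].

Lemma smooth_is_smooth (f : smooth) : is_smooth f.
Proof. by have := smoothP f; rewrite inE. Qed.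

Definition mk_smooth (f : M -> R^o) (sf : is_smooth f) : smooth :=
  Smooth (mem_set sf : f \in smooth_pred).

Definition smooth_cst (a : R) : smooth := mk_smooth (is_smooth_cst a).

Lemma smooth_ext (f g : smooth) : f =1 g -> f = g.
Proof. by move=> /funext fg; apply: val_inj. Qed.

End SmoothFunctions.

Section TangentSpace.
Variables (R : realType) (n : nat) (M : manifold R n).

(* Tangent vectors at p are the derivations of C^oo(M) at p, so that a vector
   field is a section p |-> X_p sending smooth functions to smooth functions. *)
Definition point_derivation (p : M) (v : smooth M -> R^o) :=
  (forall (a : R) f g, v (a *: f + g) = a * v f + v g) /\
  (forall f g, v (f * g) = f p * v g + g p * v f).

Definition tangent_pred (p : M) : {pred smooth M -> R^o} :=
  mem [set v | point_derivation p v].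

Record tangent (p : M) := Tangent {
  tangent_val :> smooth M -> R^o;
  tangentP : tangent_val \in tangent_pred p }.

HB.instance Definition _ p := [isSub for @tangent_val p].
HB.instance Definition _ p := [Choice of tangent p by <:].

Lemma tangent_submod_closed p : submod_closed (tangent_pred p).
Proof.
split=> [|a v w]; rewrite !inE /=.
  by split=> *; rewrite /= !(mulr0, addr0).
move=> [lv dv] [lw dw]; split=> [b f g|f g] /=.
  have E (x y z t : R) : a * (b * x + y) + (b * z + t) =
    b * (a * x + z) + (a * y + t) by ring.
  by rewrite !addrfctE /= /GRing.scale /= lv lw; exact: E.
have E (x y z t b c : R) : a * (b * x + c * y) + (b * z + c * t) =
  b * (a * x + z) + c * (a * y + t) by ring.
by rewrite !addrfctE /= /GRing.scale /= dv dw; exact: E.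
Qed.

HB.instance Definition _ p :=
  GRing.isSubmodClosed.Build R _ (tangent_pred p) (tangent_submod_closed p).
HB.instance Definition _ p := [SubChoice_isSubLmodule of tangent p by <:].

Lemma tangent_derivation p (v : tangent p) : point_derivation p v.
Proof. by have := tangentP v; rewrite inE. Qed.

Definition mk_tangent p (v : smooth M -> R^o) (dv : point_derivation p v) :
  tangent p := Tangent (mem_set dv : v \in tangent_pred p).

Lemma tangentBE p (v w : tangent p) f : (v - w) f = v f - w f.
Proof. by []. Qed.

Lemma tangentZE p (a : R) (v : tangent p) f : (a *: v) f = a *: v f.
Proof. by []. Qed.

Lemma tangent_ext p (v w : tangent p) : v =1 w -> v = w.
Proof. by move=> /funext vw; apply: val_inj. Qed.

End TangentSpace.

Section VectorFields.
Variables (R : realType) (n : nat) (M : manifold R n).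

Record vfield := VField {
  vfield_val :> forall p : M, tangent p;
  vfield_smooth : forall f : smooth M, is_smooth (fun p => vfield_val p f) }.

Definition vact (X : vfield) (f : smooth M) : smooth M :=
  mk_smooth (vfield_smooth X f).

Lemma vfield_ext (X Y : vfield) : (forall p, X p = Y p) -> X = Y.
Proof.
case: X Y => [X sX] [Y sY] /= XY.
have {}XY : X = Y by exact: functional_extensionality_dep.
by subst Y; congr VField; exact: Prop_irrelevance.
Qed.

HB.instance Definition _ := gen_eqMixin vfield.
HB.instance Definition _ := gen_choiceMixin vfield.

Program Definition vfield0 := @VField (fun p => 0) _.
Next Obligation. by move=> f; exact: is_smooth_cst. Qed.

Program Definition vfieldD (X Y : vfield) := @VField (fun p => X p + Y p) _.
Next Obligation.
by move=> X Y f; exact: (is_smoothD (vfield_smooth X f) (vfield_smooth Y f)).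
Qed.

Program Definition vfieldN (X : vfield) := @VField (fun p => - X p) _.
Next Obligation.
move=> X f; have := is_smoothZ (-1) (vfield_smooth X f).
by rewrite scaleN1r.
Qed.

Program Definition vfieldZ (h : smooth M) (X : vfield) :=
  @VField (fun p => h p *: X p) _.
Next Obligation.
move=> h X f.
exact: (is_smoothM (smooth_is_smooth h) (vfield_smooth X f)).
Qed.

Let addA : associative vfieldD.
Proof. by move=> X Y Z; apply: vfield_ext => p; exact: addrA. Qed.
Let addC : commutative vfieldD.
Proof. by move=> X Y; apply: vfield_ext => p; exact: addrC. Qed.
Let add0 : left_id vfield0 vfieldD.
Proof. by move=> X; apply: vfield_ext => p; exact: add0r. Qed.
Let addN : left_inverse vfield0 vfieldN vfieldD.
Proof. by move=> X; apply: vfield_ext => p; exact: addNr. Qed.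

HB.instance Definition _ := GRing.isZmodule.Build vfield addA addC add0 addN.

Let scaleA h k X : vfieldZ h (vfieldZ k X) = vfieldZ (h * k) X.
Proof. by apply: vfield_ext => p; exact: scalerA. Qed.
Let scale1 : left_id 1 vfieldZ.
Proof. by move=> X; apply: vfield_ext => p; exact: scale1r. Qed.
Let scaleDr : right_distributive vfieldZ +%R.
Proof. by move=> h X Y; apply: vfield_ext => p; exact: scalerDr. Qed.
Let scaleDl X : {morph vfieldZ^~ X : h k / h + k}.
Proof. by move=> h k; apply: vfield_ext => p; exact: scalerDl. Qed.

HB.instance Definition _ :=
  GRing.Zmodule_isLmodule.Build (smooth M) vfield scaleA scale1 scaleDr scaleDl.

Lemma vact_linear (X : vfield) (a : R) f g :
  vact X (a *: f + g) = a *: vact X f + vact X g.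
Proof.
by apply: smooth_ext => p; exact: (tangent_derivation (X p)).1.
Qed.

Lemma vactM (X : vfield) f g : vact X (f * g) = f * vact X g + g * vact X f.
Proof.
by apply: smooth_ext => p; exact: (tangent_derivation (X p)).2.
Qed.

Lemma vactD (X : vfield) f g : vact X (f + g) = vact X f + vact X g.
Proof. by have := vact_linear X 1 f g; rewrite !scale1r. Qed.

Lemma bracket_derivation (X Y : vfield) p :
  point_derivation p (fun f => X p (vact Y f) - Y p (vact X f)).
Proof.
have [lX dX] := tangent_derivation (X p).
have [lY dY] := tangent_derivation (Y p).
have DX u v : X p (u + v) = X p u + X p v.
  by have := lX 1 u v; rewrite scale1r mul1r.
have DY u v : Y p (u + v) = Y p u + Y p v.
  by have := lY 1 u v; rewrite scale1r mul1r.
split=> [a f g|f g].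
  have E (x y z t : R) :
    a * x + y - (a * z + t) = a * (x - z) + (y - t) by ring.
  by rewrite !vact_linear lX lY; exact: E.
have E (F G xf xg yf yg xyf xyg yxf yxg : R) :
  F * xyg + yg * xf + (G * xyf + yf * xg) -
    (F * yxg + xg * yf + (G * yxf + xf * yg)) =
  F * (xyg - yxg) + G * (xyf - yxf) by ring.
by rewrite !vactM DX DY !dX !dY; exact: E.
Qed.

Program Definition bracket (X Y : vfield) : vfield :=
  @VField (fun p => mk_tangent (bracket_derivation X Y p)) _.
Next Obligation.
by move=> X Y f; exact: is_smoothB (vfield_smooth X (vact Y f))
                                   (vfield_smooth Y (vact X f)).
Qed.

End VectorFields.

Section Tensors.
Variables (R : realType) (n : nat) (M : manifold R n).

(* Tensor fields are pointwise objects; they are smooth when they send smooth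
   vector fields to smooth vector fields (or functions, for a metric). *)
Record tensor11 := Tensor11 {
  tensor11_val :> forall p : M, {linear tangent p -> tangent p};
  tensor11_smooth : forall (X : vfield M) (f : smooth M),
    is_smooth (fun p => tensor11_val p (X p) f) }.

Definition tapp (t : tensor11) (X : vfield M) : vfield M :=
  VField (tensor11_smooth t X).

Record riemannian_metric := RiemannianMetric {
  metric_val :> forall p : M, tangent p -> tangent p -> R;
  metric_linear : forall p (a : R) (u v w : tangent p),
    metric_val (a *: u + v) w = a * metric_val u w + metric_val v w;
  metric_sym : forall p (u v : tangent p), metric_val u v = metric_val v u;
  metric_posdef : forall p (u : tangent p), u != 0 -> 0 < metric_val u u;
  metric_smooth : forall X Y : vfield M,
    is_smooth (fun p => metric_val (X p) (Y p)) }.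

Definition gapp (g : riemannian_metric) (X Y : vfield M) : smooth M :=
  mk_smooth (metric_smooth g X Y).

Record connection := Connection {
  nabla :> vfield M -> vfield M -> vfield M;
  nabla_linearl : forall (f : smooth M) X X' Y,
    nabla (f *: X + X') Y = f *: nabla X Y + nabla X' Y;
  nabla_addr : forall X Y Y', nabla X (Y + Y') = nabla X Y + nabla X Y';
  nabla_leibniz : forall X (f : smooth M) Y,
    nabla X (f *: Y) = vact X f *: Y + f *: nabla X Y }.

Definition torsion (D : connection) (X Y : vfield M) : vfield M :=
  D X Y - D Y X - bracket X Y.

(* (nabla_X t) Y *)
Definition nabla_tensor (D : connection) (t : tensor11) (X Y : vfield M) :
    vfield M :=
  D X (tapp t Y) - tapp t (D X Y).

(* (nabla_X g)(Y, Z) *)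
Definition nabla_metric (D : connection) (g : riemannian_metric)
    (X Y Z : vfield M) : smooth M :=
  vact X (gapp g Y Z) - gapp g (D X Y) Z - gapp g Y (D X Z).

(* The Levi-Civita connection is characterized as the torsion-free metric
   connection. *)
Definition levi_civita (g : riemannian_metric) (D : connection) :=
  (forall X Y, torsion D X Y = 0) /\ (forall X Y Z, nabla_metric D g X Y Z = 0).

End Tensors.

Section Golden.
Variables (R : realType) (n : nat) (M : manifold R n).
Implicit Types (phi : tensor11 M) (g : riemannian_metric M) (D : connection M).

(* The second clause is the minimality of the degree of the polynomial
   structure: phi_p and Id are linearly independent at every point p. *)
Definition almost_golden phi :=
  (forall p (v : tangent p), phi p (phi p v) = phi p v + v) /\
  (forall (p : M) (a b : R),
     (forall v : tangent p, a *: phi p v + b *: v = 0) -> a = 0 /\ b = 0).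

Definition almost_golden_riemannian phi g :=
  almost_golden phi /\
  (forall X Y : vfield M, gapp g (tapp phi X) Y = gapp g X (tapp phi Y)).

Definition product_structure_at phi (p : M) (v : tangent p) : tangent p :=
  (Num.sqrt 5)^-1 *: (2 *: phi p v - v).

Lemma product_structure_at_linear phi p : linear (@product_structure_at phi p).
Proof.
move=> a u v; rewrite /product_structure_at.
have -> : 2 *: phi p (a *: u + v) - (a *: u + v) =
    a *: (2 *: phi p u - u) + (2 *: phi p v - v).
  by rewrite linearP scalerDr scalerBr !scalerA [a * 2]mulrC opprD addrACA.
by rewrite scalerDr !scalerA [_^-1 * a]mulrC.
Qed.

HB.instance Definition _ phi p :=
  GRing.isLinear.Build R (tangent p) (tangent p) _ (@product_structure_at phi p)
    (@product_structure_at_linear phi p).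

Lemma product_structure_smooth phi (X : vfield M) (f : smooth M) :
  is_smooth (fun p => product_structure_at phi (X p) f).
Proof.
have s2 := is_smoothZ 2 (tensor11_smooth phi X f).
exact: (is_smoothZ (Num.sqrt 5)^-1 (is_smoothB s2 (vfield_smooth X f))).
Qed.

Definition product_structure phi : tensor11 M :=
  @Tensor11 _ _ _ (fun p => @product_structure_at phi p)
    (product_structure_smooth phi).

Definition nijenhuis phi (X Y : vfield M) : vfield M :=
  tapp phi (tapp phi (bracket X Y)) + bracket (tapp phi X) (tapp phi Y)
  - tapp phi (bracket (tapp phi X) Y) - tapp phi (bracket X (tapp phi Y)).

Definition integrable_structure phi := forall X Y, nijenhuis phi X Y = 0.

Definition adapted phi g D :=
  (forall X Y, nabla_tensor D phi X Y = 0) /\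
  (forall X Y Z, nabla_metric D g X Y Z = 0).

(* D is meant to be the Levi-Civita connection of the metric. *)
Definition first_canonical_nabla phi D (X Y : vfield M) : vfield M :=
  let J := product_structure phi in
  D X Y - smooth_cst M 2^-1 *: nabla_tensor D J X (tapp J Y).

Lemma tappD (t : tensor11 M) X Y : tapp t (X + Y) = tapp t X + tapp t Y.
Proof. by apply: vfield_ext => p; exact: (linearD (t p)). Qed.

Lemma tappZ (t : tensor11 M) (f : smooth M) X : tapp t (f *: X) = f *: tapp t X.
Proof. by apply: vfield_ext => p; exact: (linearZZ (t p)). Qed.

Lemma nabla_tensor_linearl D t (f : smooth M) X X' Y :
  nabla_tensor D t (f *: X + X') Y =
  f *: nabla_tensor D t X Y + nabla_tensor D t X' Y.
Proof.
by rewrite /nabla_tensor !nabla_linearl tappD tappZ scalerBr opprD addrACA.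
Qed.

Lemma nabla_tensorD D t X Y Y' :
  nabla_tensor D t X (Y + Y') = nabla_tensor D t X Y + nabla_tensor D t X Y'.
Proof.
by rewrite /nabla_tensor tappD !nabla_addr tappD opprD addrACA.
Qed.

Lemma nabla_tensorZ D t (f : smooth M) X Y :
  nabla_tensor D t X (f *: Y) = f *: nabla_tensor D t X Y.
Proof.
rewrite /nabla_tensor tappZ !nabla_leibniz tappD !tappZ scalerBr.
by rewrite opprD addrACA subrr add0r.
Qed.

Program Definition first_canonical phi D : connection M :=
  @Connection _ _ _ (first_canonical_nabla phi D) _ _ _.
Next Obligation.
move=> phi D f X X' Y; rewrite /first_canonical_nabla nabla_linearl.
rewrite nabla_tensor_linearl scalerDr opprD addrACA scalerA mulrC -scalerA.
by rewrite -scalerBr.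
Qed.
Next Obligation.
move=> phi D X Y Y'; rewrite /first_canonical_nabla nabla_addr tappD.
by rewrite nabla_tensorD scalerDr opprD addrACA.
Qed.
Next Obligation.
move=> phi D X f Y; rewrite /first_canonical_nabla nabla_leibniz tappZ.
by rewrite nabla_tensorZ scalerA mulrC -scalerA -addrA -scalerBr.
Qed.

Definition golden_ratio : R := (1 + Num.sqrt 5) / 2.
Definition golden_conj : R := (1 - Num.sqrt 5) / 2.

(* X lies in the distribution ker(phi - c Id). *)
Definition in_eigen_distribution phi (c : R) (X : vfield M) :=
  forall p : M, phi p (X p) - c *: X p = 0.

Definition well_adapted phi g D :=
  adapted phi g D /\
  forall X Z : vfield M,
    (in_eigen_distribution phi golden_ratio X /\
     in_eigen_distribution phi golden_ratio Z) \/
    (in_eigen_distribution phi golden_conj X /\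
     in_eigen_distribution phi golden_conj Z) ->
    forall Y : vfield M,
      gapp g (torsion D X Y) Z = gapp g (torsion D Z Y) X.

Definition coincide D D' := forall X Y : vfield M, D X Y = D' X Y.

End Golden.

(* Main.v *)
Require Import Defs.
From mathcomp Require Import all_boot all_order all_algebra.
From mathcomp Require Import ring lra.
From mathcomp Require Import all_classical all_reals all_analysis.

Set Implicit Arguments.
Unset Strict Implicit.
Unset Printing Implicit Defensive.

Import Order.TTheory GRing.Theory Num.Theory.
Import numFieldNormedType.Exports.

Local Open Scope ring_scope.

(** Everything takes place on the two eigendistributions of [phi], which span
the module of vector fields and are orthogonal to each other.  An eigenvalue is
a root [c] of [c ^ 2 = c + 1]; the other one is [1 - c], and treating [c] as
unknown handles both distributions at once.  By additivity, an identity between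
vector fields may be checked on eigenfields only ([eigen_ind]).

On an eigenfield [Y] of eigenvalue [c], the first canonical derivative is the
[c]-component of the Levi-Civita derivative ([first_canonicalE]).  Hence it is
adapted.  For [X], [Z] of eigenvalue [c], its torsion satisfies
[g (T (X, Y), Z) = 0] if [Y] has eigenvalue [c], and [g (T (X, Y), Z) =
g (Y, D_X Z)] if [Y] has eigenvalue [1 - c], where [D] is the Levi-Civita
connection.  As [D] has no torsion, the symmetry in [X] and [Z] that defines the
well adapted connection says exactly that [[X, Z]] is orthogonal to the
eigenvalue [1 - c], that is, that both distributions are involutive; this is
what vanishing of the Nijenhuis tensor means ([integrable_involutive]).

A well adapted connection is unique ([well_adapted_uniq]), so coinciding with
it amounts to being well adapted.  This gives (i); it also gives (ii), because
an adapted connection without torsion is trivially well adapted.  When the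
Levi-Civita connection is adapted it preserves each distribution, so taking the
component changes nothing and the first canonical connection is the same. *)

(** * Constants, brackets and the metric *)

Section VectorFieldCalculus.
Variables (R : realType) (n : nat) (M : manifold R n).
Implicit Types (X Y Z : vfield M) (D : connection M) (g : riemannian_metric M)
  (t : tensor11 M).

Lemma tangentDE p (v w : tangent p) (f : smooth M) : (v + w) f = v f + w f.
Proof. by []. Qed.

Lemma smoothDE (f h : smooth M) p : (f + h) p = f p + h p.
Proof. by []. Qed.

Lemma vact0 X : vact X 0 = 0.
Proof. by apply: (addrI (vact X 0)); rewrite -vactD !addr0. Qed.

Lemma vactZ X (a : R) (f : smooth M) : vact X (a *: f) = a *: vact X f.
Proof. by have := vact_linear X a f 0; rewrite vact0 !addr0. Qed.

Lemma vact_cst X (a : R) : vact X (smooth_cst M a) = 0.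
Proof.
have vact1 : vact X 1 = 0.
  have := vactM X 1 1; rewrite !mul1r => /(congr1 (fun h => h - vact X 1)).
  by rewrite subrr addrK => <-.
have -> : smooth_cst M a = a *: (1 : smooth M).
  by apply: smooth_ext => p; exact: esym (mulr1 a).
by rewrite vactZ vact1 scaler0.
Qed.

(** Vector fields are a module over smooth functions, so real scalars enter as
constant functions; they commute with derivatives because the derivative of a
constant vanishes. *)
Lemma nablaZc D X (a : R) Y :
  D X (smooth_cst M a *: Y) = smooth_cst M a *: D X Y.
Proof. by rewrite nabla_leibniz vact_cst scale0r add0r. Qed.

Lemma nablaDl D X X' Y : D (X + X') Y = D X Y + D X' Y.
Proof. by have := nabla_linearl D 1 X X' Y; rewrite !scale1r. Qed.

Lemma vactDl X Y f : vact (X + Y) f = vact X f + vact Y f.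
Proof. exact: smooth_ext. Qed.

Lemma vactZl (a : R) X f : vact (smooth_cst M a *: X) f = a *: vact X f.
Proof. exact: smooth_ext. Qed.

Lemma bracketE X Y p f : bracket X Y p f = X p (vact Y f) - Y p (vact X f).
Proof. by []. Qed.

Lemma tangent_addr p (v : tangent p) (f h : smooth M) : v (f + h) = v f + v h.
Proof.
by have := (tangent_derivation v).1 1 f h; rewrite scale1r mul1r.
Qed.

Lemma tangent_scaler p (v : tangent p) (a : R) (f : smooth M) :
  v (a *: f) = a * v f.
Proof.
have v0 : v 0 = 0 by apply: (addrI (v 0)); rewrite -tangent_addr !addr0.
by have := (tangent_derivation v).1 a f 0; rewrite v0 !addr0.
Qed.

Lemma bracketDl X X' Y : bracket (X + X') Y = bracket X Y + bracket X' Y.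
Proof.
apply: vfield_ext => p; apply: tangent_ext => f.
have -> : (bracket X Y + bracket X' Y) p f = bracket X Y p f + bracket X' Y p f.
  by [].
rewrite !bracketE vactDl tangent_addr addrACA -opprD.
by congr (_ - _).
Qed.

Lemma bracketC X Y : bracket X Y = - bracket Y X.
Proof.
apply: vfield_ext => p; apply: tangent_ext => f.
exact: esym (opprB _ _).
Qed.

Lemma bracketDr X Y Y' : bracket X (Y + Y') = bracket X Y + bracket X Y'.
Proof. by rewrite bracketC bracketDl opprD -!bracketC. Qed.

Lemma bracketZl (a : R) X Y :
  bracket (smooth_cst M a *: X) Y = smooth_cst M a *: bracket X Y.
Proof.
apply: vfield_ext => p; apply: tangent_ext => f.
have -> : (smooth_cst M a *: bracket X Y) p f = a * bracket X Y p f by [].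
by rewrite !bracketE vactZl tangent_scaler mulrBr.
Qed.

Lemma bracketZr (a : R) X Y :
  bracket X (smooth_cst M a *: Y) = smooth_cst M a *: bracket X Y.
Proof. by rewrite bracketC bracketZl -scalerN -bracketC. Qed.

Lemma tappN t X : tapp t (- X) = - tapp t X.
Proof. by apply: vfield_ext => p; exact: linearN. Qed.

Lemma metricC g p (u v : tangent p) : g p u v = g p v u.
Proof. exact: Defs.metric_sym. Qed.

Lemma metricDl g p (u v w : tangent p) : g p (u + v) w = g p u w + g p v w.
Proof. by have := Defs.metric_linear g 1 u v w; rewrite scale1r mul1r. Qed.

Lemma metric0l g p (w : tangent p) : g p 0 w = 0.
Proof. by apply: (addrI (g p 0 w)); rewrite -metricDl !addr0. Qed.

Lemma metricZl g p a (u w : tangent p) : g p (a *: u) w = a * g p u w.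
Proof. by have := Defs.metric_linear g a u 0 w; rewrite metric0l !addr0. Qed.

Lemma metricBl g p (u v w : tangent p) : g p (u - v) w = g p u w - g p v w.
Proof. by rewrite metricDl -scaleN1r metricZl mulN1r. Qed.

Lemma metricDr g p (u v w : tangent p) : g p w (u + v) = g p w u + g p w v.
Proof. by rewrite metricC metricDl !(metricC g _ w). Qed.

Lemma metricZr g p a (u w : tangent p) : g p w (a *: u) = a * g p w u.
Proof. by rewrite metricC metricZl metricC. Qed.

Lemma metric_eq0 g p (u : tangent p) : g p u u = 0 -> u = 0.
Proof.
move=> guu; apply/eqP; apply: contraT => /(Defs.metric_posdef g).
by rewrite guu ltxx.
Qed.

Lemma gappC g X Y : gapp g X Y = gapp g Y X.
Proof. by apply: smooth_ext => p; exact: metricC. Qed.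

Lemma gappDl g X X' Y : gapp g (X + X') Y = gapp g X Y + gapp g X' Y.
Proof. by apply: smooth_ext => p; exact: metricDl. Qed.

Lemma gappDr g X Y Y' : gapp g X (Y + Y') = gapp g X Y + gapp g X Y'.
Proof. by apply: smooth_ext => p; exact: metricDr. Qed.

Lemma nabla_metricE D g X Y Z p : (forall X Y Z, nabla_metric D g X Y Z = 0) ->
  vact X (gapp g Y Z) p = g p (D X Y p) (Z p) + g p (Y p) (D X Z p).
Proof.
move=> /(_ X Y Z) /(congr1 (fun h : smooth M => h p)).
rewrite /nabla_metric -addrA -opprD => /eqP.
by rewrite subr_eq0 => /eqP.
Qed.

Lemma nabla_metricP D g :
  (forall X Y Z p, vact X (gapp g Y Z) p =
     g p (D X Y p) (Z p) + g p (Y p) (D X Z p)) ->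
  forall X Y Z, nabla_metric D g X Y Z = 0.
Proof.
move=> H X Y Z; apply: smooth_ext => p.
have -> : nabla_metric D g X Y Z p = vact X (gapp g Y Z) p -
  g p (D X Y p) (Z p) - g p (Y p) (D X Z p) by [].
by rewrite H [_ + _ - _]addrAC addrK; exact: subrr.
Qed.

Lemma coincide_adapted phi g D D' : coincide D D' ->
  adapted phi g D' -> adapted phi g D.
Proof.
move=> DD' [a b]; split=> [X Y|X Y Z].
  by rewrite /nabla_tensor !DD'; exact: a.
by rewrite /nabla_metric !DD'; exact: b.
Qed.

End VectorFieldCalculus.

(** * The two eigendistributions *)

Section GoldenGeometry.
Variables (R : realType) (n : nat) (M : manifold R n).
Variables (phi : tensor11 M) (g : riemannian_metric M).
Hypothesis hM : almost_golden_riemannian phi g.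
Implicit Types (X Y Z W : vfield M) (D : connection M) (c d : R).

Definition golden_root c := c * c = c + 1.

Lemma golden_ratio_root : golden_root (golden_ratio R).
Proof.
rewrite /golden_root /golden_ratio.
have s5 : Num.sqrt 5 * Num.sqrt 5 = 5 :> R by rewrite -expr2 sqr_sqrtr ?ler0n.
by field: s5.
Qed.

Lemma golden_conjE : golden_conj R = 1 - golden_ratio R.
Proof. by rewrite /golden_conj /golden_ratio; field. Qed.

Lemma golden_rootC c : golden_root c -> golden_root (1 - c).
Proof. by rewrite /golden_root => hc; ring: hc. Qed.

Lemma golden_root_cases c d : golden_root c -> golden_root d ->
  d = c \/ d = 1 - c.
Proof.
rewrite /golden_root => hc hd.
have /eqP : (d - c) * (d - (1 - c)) = 0 by ring: hc hd.
by rewrite mulf_eq0 !subr_eq0 => /orP[] /eqP; [left | right].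
Qed.

(** The quantity [2 * c - 1] is the difference of the two eigenvalues, a square
root of the discriminant; it is what the projections divide by. *)
Lemma golden_root_disc c : golden_root c -> (2 * c - 1) * (2 * c - 1) = 5.
Proof. by rewrite /golden_root => hc; ring: hc. Qed.

Lemma golden_root_neq c : golden_root c -> 2 * c - 1 != 0.
Proof.
move=> hc; apply/eqP => c0; have := golden_root_disc hc.
by rewrite c0 mul0r => /eqP; rewrite eq_sym pnatr_eq0.
Qed.

Notation eigen := (in_eigen_distribution phi).

Lemma eigenP c X : eigen c X <-> tapp phi X = smooth_cst M c *: X.
Proof.
split=> [eX|eX p].
  by apply: vfield_ext => p; apply/eqP; rewrite -subr_eq0; apply/eqP/eX.
have -> : phi p (X p) = tapp phi X p by [].
by rewrite eX; exact: subrr.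
Qed.

Lemma eigenE c X p : eigen c X -> phi p (X p) = c *: X p.
Proof. by move=> /(_ p) /eqP; rewrite subr_eq0 => /eqP. Qed.

Lemma phi2 p (v : tangent p) : phi p (phi p v) = phi p v + v.
Proof. exact: hM.1.1. Qed.

(** The projection onto the eigenvalue [c], as the Lagrange interpolation
polynomial in [phi] that is 1 at [c] and 0 at [1 - c]. *)
Definition eigen_part c X : vfield M :=
  smooth_cst M (2 * c - 1)^-1 *: (tapp phi X - smooth_cst M (1 - c) *: X).

Lemma eigen_partE c X p :
  eigen_part c X p = (2 * c - 1)^-1 *: (phi p (X p) - (1 - c) *: X p).
Proof. by []. Qed.

Lemma eigen_eigen_part c X : golden_root c -> eigen c (eigen_part c X).
Proof.
move=> hc p; rewrite eigen_partE linearZ linearB linearZ phi2.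
apply: tangent_ext => f; rewrite !(tangentBE, tangentZE, tangentDE).
set a := _^-1; set u := (phi p _) f; set v := X p f.
have -> : (0 : tangent p) f = 0 by [].
rewrite /golden_root in hc; rewrite /GRing.scale /=; ring: hc.
Qed.

Lemma eigen_part_id c X : golden_root c -> eigen c X -> eigen_part c X = X.
Proof.
move=> hc eX; apply: vfield_ext => p.
rewrite eigen_partE (eigenE p eX) -scalerBl scalerA.
have -> : c - (1 - c) = 2 * c - 1 by ring.
by rewrite mulVf ?scale1r// golden_root_neq.
Qed.

Lemma eigen_part_sum c X : golden_root c ->
  X = eigen_part c X + eigen_part (1 - c) X.
Proof.
move=> hc; apply: vfield_ext => p.
have -> : (eigen_part c X + eigen_part (1 - c) X) p =
  eigen_part c X p + eigen_part (1 - c) X p by [].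
rewrite !eigen_partE; apply: tangent_ext => f.
rewrite !(tangentBE, tangentZE, tangentDE).
have h1 := golden_root_neq hc; have h2 := golden_root_neq (golden_rootC hc).
rewrite /GRing.scale /=; field.
by rewrite h1 h2.
Qed.

(** The reduction used throughout: the two projections are global vector fields,
so that no local frame is needed to reduce to eigenfields. *)
Lemma eigen_ind (P : vfield M -> Prop) :
  (forall c X, golden_root c -> eigen c X -> P X) ->
  (forall X Y, P X -> P Y -> P (X + Y)) -> forall X, P X.
Proof.
move=> Pe PD X; have hc := golden_ratio_root; have hd := golden_rootC hc.
rewrite (eigen_part_sum X hc); apply: PD.
  exact: Pe hc (eigen_eigen_part X hc).
exact: Pe hd (eigen_eigen_part X hd).
Qed.

(** A self-adjoint operator has orthogonal eigenspaces. *)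
Lemma eigen_orth c X Y p : golden_root c -> eigen c X -> eigen (1 - c) Y ->
  g p (X p) (Y p) = 0.
Proof.
move=> hc eX eY.
have : g p (phi p (X p)) (Y p) = g p (X p) (phi p (Y p)).
  exact: (congr1 (fun h : smooth M => h p) (hM.2 X Y)).
rewrite (eigenE p eX) (eigenE p eY) metricZl metricZr => h.
apply: (mulfI (golden_root_neq hc)); rewrite mulr0.
lra.
Qed.

Lemma eigen_gapp0 c X Y : golden_root c -> eigen c X -> eigen (1 - c) Y ->
  gapp g X Y = 0.
Proof.
by move=> hc eX eY; apply: smooth_ext => p; exact: eigen_orth hc eX eY.
Qed.

(** Test against the [1 - c] component of [W] itself: its norm vanishes. *)
Lemma eigen_orthP c W : golden_root c ->
  (forall Y, eigen (1 - c) Y -> forall p, g p (Y p) (W p) = 0) -> eigen c W.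
Proof.
move=> hc W0; have hd := golden_rootC hc.
suff W2 : eigen_part (1 - c) W = 0.
  rewrite (eigen_part_sum W hc) W2 addr0; exact: eigen_eigen_part.
have e1 := eigen_eigen_part W hc; have e2 := eigen_eigen_part W hd.
apply: vfield_ext => p; apply: (@metric_eq0 _ _ _ g).
have WE : W p = eigen_part c W p + eigen_part (1 - c) W p.
  exact: (congr1 (fun V : vfield M => V p) (eigen_part_sum W hc)).
have := W0 _ e2 p.
by rewrite WE metricDr metricC (eigen_orth p hc e1 e2) add0r.
Qed.

Lemma eigenB c X Y : eigen c X -> eigen c Y -> eigen c (X - Y).
Proof.
move=> eX eY p; have -> : (X - Y) p = X p - Y p by [].
by rewrite linearB (eigenE p eX) (eigenE p eY) -scalerBr subrr.
Qed.

(** * Uniqueness of the well adapted connection *)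

Lemma eigen_nabla D c X Y : (forall X Y, nabla_tensor D phi X Y = 0) ->
  eigen c Y -> eigen c (D X Y).
Proof.
move=> Dphi /eigenP eY; apply/eigenP; have /eqP := Dphi X Y.
by rewrite /nabla_tensor subr_eq0 eY nablaZc => /eqP.
Qed.

Lemma well_adapted_torsion D c X Y Z p : well_adapted phi g D ->
  golden_root c -> eigen c X -> eigen c Z ->
  g p (torsion D X Y p) (Z p) = g p (torsion D Z Y p) (X p).
Proof.
move=> [_ wD] hc eX eZ.
suff : gapp g (torsion D X Y) Z = gapp g (torsion D Z Y) X.
  exact: (congr1 (fun h : smooth M => h p)).
apply: wD; case: (golden_root_cases golden_ratio_root hc) => cE; subst c.
  by left.
by right; rewrite golden_conjE.
Qed.

Lemma metric_torsion D X Y p (w : tangent p) : g p (torsion D X Y p) w =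
  g p (D X Y p) w - g p (D Y X p) w - g p (bracket X Y p) w.
Proof. by rewrite -!metricBl. Qed.

(** The difference [S] of two well adapted connections is a tensor with values
in skew endomorphisms commuting with [phi], and subtracting the two torsion
conditions gives [s (X, Y, Z) - s (Z, Y, X) = 2 s (Y, X, Z)] for
[s (X, Y, Z) = g (S_X Y, Z)] and [X], [Z] in the same distribution.  If [Y] and
[Z] have different eigenvalues, [s] is zero by orthogonality.  If they share an
eigenvalue which [X] does not have, the relation with [X] in the middle has a
zero left-hand side.  If all three share it, cyclic permutations of the relation
form a linear system whose only solution is zero. *)
Lemma well_adapted_uniq D1 D2 : well_adapted phi g D1 ->
  well_adapted phi g D2 -> coincide D1 D2.
Proof.
move=> w1 w2.
pose s X Y Z p := g p ((D1 X Y - D2 X Y) p) (Z p).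
have sE X Y Z p : s X Y Z p = g p (D1 X Y p) (Z p) - g p (D2 X Y p) (Z p).
  exact: metricBl.
suff s0 X Y Z : forall p, s X Y Z p = 0.
  move=> X Y; apply/eqP; rewrite -subr_eq0; apply/eqP.
  apply: vfield_ext => p; apply: (@metric_eq0 _ _ _ g).
  exact: s0 X Y (D1 X Y - D2 X Y) p.
have skew X' Y' Z' p : s X' Y' Z' p = - s X' Z' Y' p.
  have := nabla_metricE X' Y' Z' p w1.1.2.
  have := nabla_metricE X' Y' Z' p w2.1.2.
  rewrite !sE !(metricC g (Y' p)) => -> h; lra.
have tors c X' Y' Z' p : golden_root c -> eigen c X' -> eigen c Z' ->
    s X' Y' Z' p - s Z' Y' X' p = 2 * s Y' X' Z' p.
  move=> hc eX eZ; have := well_adapted_torsion Y' p w1 hc eX eZ.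
  have := well_adapted_torsion Y' p w2 hc eX eZ.
  have := skew Y' X' Z' p; rewrite !metric_torsion !sE; lra.
have orth c X' Y' Z' p : golden_root c -> eigen c Y' -> eigen (1 - c) Z' ->
    s X' Y' Z' p = 0.
  move=> hc eY eZ; apply: eigen_orth hc _ eZ.
  by apply: eigenB; apply: eigen_nabla eY; [exact: w1.1.1 | exact: w2.1.1].
elim/eigen_ind: X => [c X hc eX|X X' IH IH' p]; last first.
  by have := IH p; have := IH' p; rewrite !sE !nablaDl !metricDl; lra.
elim/eigen_ind: Y => [d Y hd eY|Y Y' IH IH' p]; last first.
  by have := IH p; have := IH' p; rewrite !sE !nabla_addr !metricDl; lra.
elim/eigen_ind: Z => [e Z he eZ|Z Z' IH IH' p]; last first.
  by have := IH p; have := IH' p; rewrite /s metricDr; lra.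
move=> p; case: (golden_root_cases hd he) => eE; subst e; last exact: orth eZ.
case: (golden_root_cases hd hc) => cE; subst c.
  have := tors _ X Y Z p hd eX eZ; have := tors _ Y Z X p hd eY eX.
  have := tors _ Z X Y p hd eZ eY.
  have := skew X Y Z p; have := skew Y Z X p; have := skew Z X Y p; lra.
have := tors _ Y X Z p hd eY eZ.
rewrite (skew Y) (skew Z) (orth _ _ Z X p hd eZ eX) (orth _ _ Y X p hd eY eX).
lra.
Qed.

(** * The first canonical connection *)

Lemma eigen_part_metric c W Z p : golden_root c -> eigen c Z ->
  g p (eigen_part c W p) (Z p) = g p (W p) (Z p).
Proof.
move=> hc eZ; have WE : W p = eigen_part c W p + eigen_part (1 - c) W p.
  exact: (congr1 (fun V : vfield M => V p) (eigen_part_sum W hc)).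
have e2 := eigen_eigen_part W (golden_rootC hc).
by rewrite [in RHS]WE metricDl (metricC g (eigen_part (1 - c) W p))
  (eigen_orth p hc eZ e2) addr0.
Qed.

Lemma product_structure_eigen c Y : eigen c Y ->
  tapp (product_structure phi) Y =
  smooth_cst M ((Num.sqrt 5)^-1 * (2 * c - 1)) *: Y.
Proof.
move=> eY; apply: vfield_ext => p.
have -> : tapp (product_structure phi) Y p =
  (Num.sqrt 5)^-1 *: (2 *: phi p (Y p) - Y p) by [].
by rewrite (eigenE p eY) scalerA -[X in _ - X]scale1r -scalerBl scalerA.
Qed.

(** The product structure acts on an eigenfield by a sign [e], so
[D_X Y - (D_X J) (J Y) / 2 = (D_X Y + e * J (D_X Y)) / 2], and
[(Id + e * J) / 2] is the projection onto the distribution of [Y]. *)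
Lemma first_canonicalE D c X Y : golden_root c -> eigen c Y ->
  first_canonical phi D X Y = eigen_part c (D X Y).
Proof.
move=> hc eY; have s5 : Num.sqrt 5 != 0 :> R by rewrite sqrtr_eq0 -ltNge ltr0n.
have s25 : Num.sqrt 5 * Num.sqrt 5 = 5 :> R by rewrite -expr2 sqr_sqrtr ?ler0n.
have := product_structure_eigen eY; set e := _ * _ => JY.
rewrite /= /first_canonical_nabla /nabla_tensor JY tappZ JY !nablaZc tappZ.
apply: vfield_ext => p; apply: tangent_ext => f.
rewrite eigen_partE; set V := D X Y.
have -> : (V - smooth_cst M 2^-1 *: (smooth_cst M e *: (smooth_cst M e *: V) -
      smooth_cst M e *: tapp (product_structure phi) V)) p =
    V p - 2^-1 *: (e *: (e *: V p) -
      e *: ((Num.sqrt 5)^-1 *: (2 *: phi p (V p) - V p))) by [].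
rewrite !(tangentBE, tangentZE) /GRing.scale /=.
have h := golden_root_neq hc; have h5 := golden_root_disc hc.
have ee : e * e = 1.
  by rewrite /e mulrACA h5 -invfM s25 mulVf ?pnatr_eq0.
have eE : e * (Num.sqrt 5)^-1 = (2 * c - 1)^-1.
  apply: (mulIf h); rewrite mulVf // -mulrA; exact: ee.
set u := (V p) f; set w := (phi p _) f.
have -> : u - 2^-1 * (e * (e * u) - e * ((Num.sqrt 5)^-1 * (2 * w - u))) =
    u - 2^-1 * ((e * e) * u - (e * (Num.sqrt 5)^-1) * (2 * w - u)) by ring.
by rewrite eE ee; field.
Qed.

(** Differentiating inside each distribution preserves it, hence commutes with
[phi].  The metric is parallel on fields of the same eigenvalue since the
discarded component is orthogonal to the distribution, and on fields of
different eigenvalues since every term is zero. *)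
Lemma first_canonical_adapted D : levi_civita g D ->
  adapted phi g (first_canonical phi D).
Proof.
move=> [_ Dg]; split=> [X|].
  elim/eigen_ind=> [c Y hc eY|Y Y' IH IH']; last first.
    by rewrite nabla_tensorD IH IH' addr0.
  have /eigenP eDY : eigen c (first_canonical phi D X Y).
    by rewrite (first_canonicalE D X hc eY); exact: eigen_eigen_part.
  by move/eigenP: eY => eY; rewrite /nabla_tensor eDY eY nablaZc subrr.
apply: nabla_metricP => X.
elim/eigen_ind=> [c Y hc eY|Y Y' IH IH' Z p]; last first.
  rewrite gappDl vactD !nabla_addr.
  by rewrite smoothDE IH IH' !metricDl; ring.
elim/eigen_ind=> [d Z hd eZ|Z Z' IH IH' p]; last first.
  rewrite gappDr vactD !nabla_addr.
  by rewrite smoothDE IH IH' !metricDr; ring.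
move=> p; rewrite (first_canonicalE D X hc eY) (first_canonicalE D X hd eZ).
case: (golden_root_cases hc hd) => dE; subst d.
  rewrite eigen_part_metric// (metricC g (Y p)) eigen_part_metric//.
  by rewrite (nabla_metricE _ _ _ _ Dg) (metricC g (Y p)).
rewrite (eigen_gapp0 hc eY eZ) vact0.
rewrite (eigen_orth p hc (eigen_eigen_part _ hc) eZ).
by rewrite (eigen_orth p hc eY (eigen_eigen_part _ hd)) addr0.
Qed.

Lemma nabla_torsion_free D X Y p (w : tangent p) : levi_civita g D ->
  g p (bracket X Y p) w = g p (D X Y p) w - g p (D Y X p) w.
Proof.
move=> [/(_ X Y) /(congr1 (fun V : vfield M => V p)) T0 _].
have : g p (torsion D X Y p) w = 0 by rewrite T0 metric0l.
by rewrite metric_torsion; lra.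
Qed.

(** In [D0_X Y - D0_Y X - [X, Y]], the first term is orthogonal to [Z], and the
other two add up to [- D_X Y] when paired with [Z], as [D] has no torsion;
finally [g (D_X Y, Z) = - g (Y, D_X Z)] because [g (Y, Z) = 0]. *)
Lemma first_canonical_torsion D c X Y Z p : levi_civita g D ->
  golden_root c -> eigen c X -> eigen c Z -> eigen (1 - c) Y ->
  g p (torsion (first_canonical phi D) X Y p) (Z p) = g p (Y p) (D X Z p).
Proof.
move=> lc hc eX eZ eY; rewrite metric_torsion (nabla_torsion_free _ _ _ lc).
rewrite (first_canonicalE D X (golden_rootC hc) eY).
rewrite (first_canonicalE D Y hc eX).
rewrite (eigen_part_metric _ p hc eZ) (metricC g (eigen_part (1 - c) _ p)).
rewrite (eigen_orth p hc eZ (eigen_eigen_part _ (golden_rootC hc))).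
have := nabla_metricE X Y Z p lc.2; rewrite gappC (eigen_gapp0 hc eZ eY) vact0.
have -> : (0 : smooth M) p = 0 :> R by [].
lra.
Qed.

(** Within one distribution, pairing with [Z] does not see the projection, and
the torsion of the Levi-Civita connection remains. *)
Lemma first_canonical_torsion0 D c X Y Z p : levi_civita g D ->
  golden_root c -> eigen c X -> eigen c Z -> eigen c Y ->
  g p (torsion (first_canonical phi D) X Y p) (Z p) = 0.
Proof.
move=> lc hc eX eZ eY; rewrite metric_torsion (nabla_torsion_free _ _ _ lc).
rewrite (first_canonicalE D X hc eY) (first_canonicalE D Y hc eX).
by rewrite !eigen_part_metric// subrr.
Qed.

(** * Involutivity and the Nijenhuis tensor *)

Lemma metric_bracket D X Y Z p : levi_civita g D ->
  g p (Y p) (bracket X Z p) = g p (Y p) (D X Z p) - g p (Y p) (D Z X p).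
Proof.
by move=> lc; rewrite metricC (nabla_torsion_free _ _ _ lc) !(metricC g (Y p)).
Qed.

Definition involutive_eigen := forall c X Z, golden_root c ->
  eigen c X -> eigen c Z -> eigen c (bracket X Z).

Lemma first_canonical_well_adapted D : levi_civita g D -> involutive_eigen ->
  well_adapted phi g (first_canonical phi D).
Proof.
move=> lc inv; split; first exact: first_canonical_adapted.
move=> X Z eXZ.
have [c [hc eX eZ]] : exists c, [/\ golden_root c, eigen c X & eigen c Z].
  case: eXZ => -[eX eZ]; first by exists (golden_ratio R); split=> //;
    exact: golden_ratio_root.
  exists (golden_conj R); split=> //; rewrite golden_conjE.
  exact: golden_rootC golden_ratio_root.
suff H Y : forall p, g p (torsion (first_canonical phi D) X Y p) (Z p) =
    g p (torsion (first_canonical phi D) Z Y p) (X p).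
  by move=> Y; apply: smooth_ext => p; exact: H.
elim/eigen_ind: Y => [d Y hd eY|Y Y' IH IH'] p; last first.
  have := IH p; have := IH' p; rewrite !metric_torsion.
  by rewrite !nabla_addr !nablaDl !bracketDr !metricDl; lra.
case: (golden_root_cases hc hd) => dE; subst d.
  by rewrite !(@first_canonical_torsion0 _ c).
(* The two sides differ by the pairing of Y with the bracket of X and Z. *)
rewrite !(@first_canonical_torsion _ c)//; apply/eqP; rewrite -subr_eq0.
rewrite -(metric_bracket _ _ _ _ lc) metricC; apply/eqP.
by apply: eigen_orth hc (inv _ _ _ hc eX eZ) eY.
Qed.

Lemma well_adapted_involutive D : levi_civita g D ->
  well_adapted phi g (first_canonical phi D) -> involutive_eigen.
Proof.
move=> lc w c X Z hc eX eZ; apply: (eigen_orthP hc) => Y eY p.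
have := well_adapted_torsion Y p w hc eX eZ.
rewrite !(@first_canonical_torsion _ c)// (metric_bracket _ _ _ _ lc) => ->.
exact: subrr.
Qed.

Lemma nijenhuis_eigen c X Z p : eigen c X -> eigen c Z ->
  nijenhuis phi X Z p =
  (1 - 2 * c) *: phi p (bracket X Z p) + (1 + c * c) *: bracket X Z p.
Proof.
move=> /eigenP eX /eigenP eZ; rewrite /nijenhuis eX eZ !bracketZl !bracketZr.
rewrite !tappZ; set B := bracket X Z.
have -> : (tapp phi (tapp phi B) + smooth_cst M c *: (smooth_cst M c *: B) -
    smooth_cst M c *: tapp phi B - smooth_cst M c *: tapp phi B) p =
  phi p (phi p (B p)) + c *: (c *: B p) - c *: phi p (B p) - c *: phi p (B p).
  by [].
rewrite phi2; apply: tangent_ext => f.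
rewrite !(tangentBE, tangentDE, tangentZE) /GRing.scale /=; ring.
Qed.

(** Here the Nijenhuis tensor is [phi ^ 2 + c * (1 - c) - phi] applied to the
bracket, which is zero as the eigenvalues have product -1. *)
Lemma nijenhuis_eigenC c X Z : golden_root c -> eigen c X -> eigen (1 - c) Z ->
  nijenhuis phi X Z = 0.
Proof.
move=> hc /eigenP eX /eigenP eZ; rewrite /nijenhuis eX eZ !bracketZl !bracketZr.
rewrite !tappZ; set B := bracket X Z; apply: vfield_ext => p.
have -> : (tapp phi (tapp phi B) + smooth_cst M c *: (smooth_cst M (1 - c) *: B)
    - smooth_cst M c *: tapp phi B - smooth_cst M (1 - c) *: tapp phi B) p =
  phi p (phi p (B p)) + c *: ((1 - c) *: B p) - c *: phi p (B p)
    - (1 - c) *: phi p (B p) by [].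
rewrite phi2; apply: tangent_ext => f.
have -> : (0 : vfield M) p f = 0 by [].
rewrite !(tangentBE, tangentDE, tangentZE) /GRing.scale /=.
by rewrite /golden_root in hc; ring: hc.
Qed.

Lemma nijenhuisDl X X' Z :
  nijenhuis phi (X + X') Z = nijenhuis phi X Z + nijenhuis phi X' Z.
Proof.
rewrite /nijenhuis !(tappD, bracketDl) !opprD.
by rewrite [X in X + _ + _ = _]addrACA [X in X + _ = _]addrACA [LHS]addrACA.
Qed.

Lemma nijenhuisC X Z : nijenhuis phi X Z = - nijenhuis phi Z X.
Proof.
rewrite /nijenhuis (bracketC X) (bracketC (tapp phi X)) (bracketC (tapp phi X)).
rewrite (bracketC X) !tappN !opprD !opprK -!addrA; congr (_ + (_ + _)).
exact: addrC.
Qed.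

(** On two fields of eigenvalue [c] the Nijenhuis tensor is
[(phi - c) ^ 2 = (1 - 2 * c) * (phi - c)] applied to their bracket, and on
fields of different eigenvalues it always vanishes. *)
Lemma integrable_involutive : integrable_structure phi <-> involutive_eigen.
Proof.
split=> [N0 c X Z hc eX eZ p|inv X Z].
  have := nijenhuis_eigen p eX eZ; rewrite N0 => h.
  have h1 := golden_root_neq hc.
  have : (1 - 2 * c) *: (phi p (bracket X Z p) - c *: bracket X Z p) = 0.
    rewrite [RHS]h scalerBr scalerA -scaleNr; congr (_ + _ *: _).
    by rewrite /golden_root in hc; ring: hc.
  move=> /eqP; rewrite scaler_eq0 => /orP[/eqP c0|/eqP //].
  by case/eqP: h1; rewrite -oppr0 -c0; ring.
elim/eigen_ind: X => [c X hc eX|X X' IH IH']; last first.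
  by rewrite nijenhuisDl IH IH' addr0.
elim/eigen_ind: Z => [d Z hd eZ|Z Z' IH IH']; last first.
  by rewrite nijenhuisC nijenhuisDl !(nijenhuisC _ X) IH IH' !oppr0 addr0 oppr0.
case: (golden_root_cases hc hd) => dE; subst d; last first.
  exact: nijenhuis_eigenC eX eZ.
apply: vfield_ext => p; rewrite (nijenhuis_eigen p eX eZ).
rewrite (eigenE p (inv _ _ _ hc eX eZ)) scalerA -scalerDl.
have -> : (1 - 2 * c) * c + (1 + c * c) = 0.
  by rewrite /golden_root in hc; ring: hc.
exact: scale0r.
Qed.

(** * Comparison of the three connections *)

Lemma torsion_free_well_adapted D : levi_civita g D -> adapted phi g D ->
  well_adapted phi g D.
Proof.
move=> [T0 _] aD; split=> // X Z _ Y; rewrite !T0.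
by apply: smooth_ext => p; rewrite /= !metric0l.
Qed.

Lemma coincide_well_adapted D D' : coincide D D' -> well_adapted phi g D' ->
  well_adapted phi g D.
Proof.
move=> DD' [a w]; split; first exact: coincide_adapted DD' a.
by move=> X Z eXZ Y; have := w X Z eXZ Y; rewrite /torsion !DD'.
Qed.

Lemma adapted_first_canonical D :
  adapted phi g D -> coincide D (first_canonical phi D).
Proof.
move=> [Dphi _] X Y; elim/eigen_ind: Y => [c Y hc eY|Y Y' IH IH']; last first.
  by rewrite !nabla_addr IH IH'.
rewrite (first_canonicalE D X hc eY); have eD := eigen_nabla X Dphi eY.
exact: esym (eigen_part_id hc eD).
Qed.

End GoldenGeometry.

Theorem corollary5p6 (R : realType) (n : nat) (M : manifold R n)
    (phi : tensor11 M) (g : riemannian_metric M)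
    (Dg Dw : connection M)
    (hM : almost_golden_riemannian phi g)
    (hg : levi_civita g Dg)
    (hw : well_adapted phi g Dw) :
  (coincide (first_canonical phi Dg) Dw <-> integrable_structure phi) /\
  ((coincide Dg Dw <-> adapted phi g Dg) /\
   (coincide Dg Dw ->
      coincide Dg (first_canonical phi Dg) /\
      coincide Dw (first_canonical phi Dg))).
Proof.
split; [split=> [eq0w|/(integrable_involutive hM) inv]|].
- apply/(integrable_involutive hM)/(well_adapted_involutive hM hg).
  exact: coincide_well_adapted eq0w hw.
- exact: well_adapted_uniq (first_canonical_well_adapted hM hg inv) hw.
have adaptedP : coincide Dg Dw <-> adapted phi g Dg.
  split=> [eqgw|aDg]; first exact: coincide_adapted eqgw hw.1.
  exact: well_adapted_uniq (torsion_free_well_adapted hg aDg) hw.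
split=> // eqgw; have eqg0 := adapted_first_canonical hM (adaptedP.1 eqgw).
by split=> // X Y; rewrite -eqgw.
Qed.
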